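(* Let $C_{37}$ be the simplicial complex obtained from $37$ disjoint copies of $Q^*$ by identifying them along the subcomplex $A^*$. Then $C_{37}$ is balanced, Cohen-Macaulay (over any field), and not partitionable.
   Context: $Q^*$ is the $3$-dimensional simplicial complex on vertex set $\{0,1,\dots,13\}$ whose faces are all subsets of the following $20$ facets: $\{2,5,6,12\}$, $\{1,5,8,11\}$, $\{0,1,2,5\}$, $\{1,4,8,9\}$, $\{1,2,3,10\}$, $\{4,5,8,13\}$, $\{0,1,2,3\}$, $\{1,4,9,10\}$, $\{1,2,9,10\}$, $\{1,2,5,6\}$, $\{0,2,5,12\}$, $\{4,5,7,13\}$, $\{1,4,5,8\}$, $\{1,2,6,9\}$, $\{1,3,4,7\}$, $\{1,3,4,10\}$, $\{1,5,6,11\}$, $\{1,4,5,7\}$, $\{1,6,9,11\}$, $\{1,8,9,11\}$. $A^*$ is the induced subcomplex of $Q^*$ on vertex set $\{0,2,3,4,6,7,8,10,12,13\}$; its facets are $\{0,2,3\}$, $\{4,7,13\}$, $\{3,4,10\}$, $\{0,2,12\}$, $\{3,4,7\}$, $\{2,3,10\}$, $\{2,6,12\}$, $\{4,8,13\}$. Identifying $N$ copies of $Q^*$ along $A^*$ means taking copies $Q^*_1,\dots,Q^*_N$ with pairwise disjoint vertex sets except that the vertices of $A^*$ are shared (the same in all copies). A $(d-1)$-dimensional complex is balanced if its graph is properly $d$-colorable. A pure simplicial complex with facets $F_1,\dots,F_n$ is partitionable if its faces are the disjoint union of Boolean intervals $[R_i,F_i]=\{G: R_i\subseteq G\subseteq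 F_i\}$. A $(d-1)$-dimensional complex $\Delta$ is Cohen-Macaulay over a field $\mathbb{F}$ if for every face $F$ (including $\emptyset$), $\widetilde{H}_i(\mathrm{lk}_\Delta(F);\mathbb{F})=0$ for all $i\neq d-1-\#F$, where $\mathrm{lk}_\Delta(F)=\{G\in\Delta: G\cap F=\emptyset, G\cup F\in\Delta\}$. *)

(* Defs.v *)
From HB Require Import structures.
From mathcomp Require Import all_boot all_order all_algebra.
Set Implicit Arguments. Unset Strict Implicit. Unset Printing Implicit Defensive.
Import GRing.Theory.

(** * Abstract simplicial complexes on a finite vertex type [T],
      represented by their set of faces (the empty face included). *)

Section Complexes.
Variable T : finType.
Implicit Types (D : {set {set T}}) (s t : {set T}).

(** d = (dimension + 1) = maximal face cardinality. *)
Definition cdim D : nat := \max_(s in D) #|s|.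

Definition link D s : {set {set T}} :=
  [set g in D | [disjoint g & s] && (g :|: s \in D)].

(** Fixed total order on vertices, used to orient simplices. *)
Definition vlt (u v : T) : bool := (enum_rank u < enum_rank v)%N.

(** Reduced simplicial chains over a field: a [k]-chain assigns a coefficient
    to each face of cardinality [k] (i.e. of dimension k-1, the empty face
    giving the augmentation degree -1). *)
Definition chain_on (F : fieldType) D (k : nat) (c : {ffun {set T} -> F}) :=
  forall s, (c s != 0)%R -> (s \in D) && (#|s| == k).

Definition bdry (F : fieldType) (c : {ffun {set T} -> F}) : {ffun {set T} -> F} :=
  [ffun t : {set T} => (\sum_(v : T | v \notin t)
      ((-1) ^+ #|[set u in t | vlt u v]| * c (v |: t)))%R].

(** \tilde H_{k-1}(D; F) = 0 : every (k-1)-cycle is a boundary. *)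
Definition rhomology_vanishes (F : fieldType) D (k : nat) :=
  forall c : {ffun {set T} -> F}, chain_on D k c -> bdry c = 0%R ->
    exists b : {ffun {set T} -> F}, chain_on D k.+1 b /\ bdry b = c.

(** Cohen-Macaulay over F: for every face s and every i <> d-1-#s,
    \tilde H_i(lk s; F) = 0 (with i = k-1; degrees i < -1 are trivially 0). *)
Definition CohenMacaulay (F : fieldType) D :=
  forall s, s \in D -> forall k : nat, k != (cdim D - #|s|)%N ->
    rhomology_vanishes F (link D s) k.

Definition balanced D :=
  exists col : T -> 'I_(cdim D),
    forall u v, u != v -> [set u; v] \in D -> col u != col v.

Definition facet D s := (s \in D) && [forall g in D, (s \subset g) ==> (g == s)].

Definition partitionable D :=
  exists R : {set T} -> {set T},
    (forall f, facet D f -> R f \subset f) /\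
    (forall g, g \in D -> exists! f, facet D f /\ R f \subset g /\ g \subset f).

End Complexes.

Definition Qfacets : seq (seq nat) :=
  [:: [:: 2;5;6;12]; [:: 1;5;8;11]; [:: 0;1;2;5]; [:: 1;4;8;9]; [:: 1;2;3;10];
      [:: 4;5;8;13]; [:: 0;1;2;3]; [:: 1;4;9;10]; [:: 1;2;9;10]; [:: 1;2;5;6];
      [:: 0;2;5;12]; [:: 4;5;7;13]; [:: 1;4;5;8]; [:: 1;2;6;9]; [:: 1;3;4;7];
      [:: 1;3;4;10]; [:: 1;5;6;11]; [:: 1;4;5;7]; [:: 1;6;9;11]; [:: 1;8;9;11]].

Definition Qstar : {set {set 'I_14}} :=
  [set s : {set 'I_14} | has (fun f : seq nat => s \subset [set x : 'I_14 | val x \in f]) Qfacets].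

Definition Avert : {set 'I_14} :=
  [set x : 'I_14 | val x \in [:: 0;2;3;4;6;7;8;10;12;13]].

Definition Astar : {set {set 'I_14}} := [set s in Qstar | s \subset Avert].

(** Gluing N copies (indexed by 'I_N) of Q* along A*: vertex v of copy i is
    (v, i) if v is not a vertex of A*, and the shared vertex (v, 0) otherwise. *)
Definition glue_vertex (N : nat) (i : 'I_N.+1) (v : 'I_14) : 'I_14 * 'I_N.+1 :=
  if v \in Avert then (v, ord0) else (v, i).

Definition Cglue (N : nat) : {set {set ('I_14 * 'I_N.+1)}} :=
  [set S : {set ('I_14 * 'I_N.+1)} | [exists i : 'I_N.+1, exists s in Qstar, S == glue_vertex i @: s]].

(** C_37 : 37 copies. *)
Definition C37 := Cglue 36.

(* Main.v *)
Require Import Defs.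
From mathcomp Require Import all_boot all_order all_algebra.
Set Implicit Arguments. Unset Strict Implicit. Unset Printing Implicit Defensive.
Import GRing.Theory.

(** Write [Q] and [A] for the starred complexes. They are shellable, of
    dimensions 3 and 2, and distinct copies of [Q] meet exactly in [A], so the
    glued complex is constructible, hence Cohen-Macaulay over every field by
    Mayer-Vietoris. Since [A] has 36 faces, in any partitioning of 37 glued
    copies some copy has all of its interval bottoms outside [A]; the
    partitioning then restricts to one of the faces of [Q] outside [A]. Those
    faces cannot be partitioned: repeatedly discarding every interval [I] for
    which some face lies in no remaining interval equal to or disjoint from [I]
    leaves nothing after four rounds. *)

(** * Reduced simplicial chains: the boundary operator and acyclicity criteria *)

Section Homology.
Variables (T : finType) (F : fieldType).
Implicit Types (D : {set {set T}}) (s t : {set T}) (c : {ffun {set T} -> F}).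
Local Open Scope ring_scope.

Definition downclosed D := forall s t, s \in D -> t \subset s -> t \in D.

Definition osign t v : F := (-1) ^+ #|[set u in t | vlt u v]|.

Lemma bdryE c t :
  bdry c t = \sum_(v | v \notin t) osign t v * c (v |: t).
Proof. by rewrite ffunE. Qed.

Lemma vlt_total (v w : T) : v != w -> vlt v w = ~~ vlt w v.
Proof.
move=> vw; rewrite /vlt -leqNgt ltn_neqAle; case: eqP => //= e.
by case/eqP: vw; apply: enum_rank_inj; apply: val_inj.
Qed.

(** Inserting [v] shifts the position of [w] by one exactly when [v] precedes [w]. *)
Lemma osignU1 t v w :
  v \notin t -> osign (v |: t) w = (-1) ^+ vlt v w * osign t w.
Proof.
move=> vt; rewrite /osign; case vw: (vlt v w).
  rewrite -exprD; congr (_ ^+ _).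
  rewrite (_ : [set u in _ | _] = v |: [set u in t | vlt u w]).
    by rewrite cardsU1 inE (negbTE vt).
  by apply/setP=> u; rewrite !inE; case: eqP => [->|].
rewrite expr0 mul1r; congr (_ ^+ _); apply: eq_card => u; rewrite !inE.
by case: eqP => [->|] //=; rewrite vw andbF.
Qed.

Lemma osign_sqr t v : osign t v * osign t v = 1.
Proof. by rewrite -expr2 sqrr_sign. Qed.

(** Exactly one of [v], [w] precedes the other, so exactly one of the two insertion orders picks up
    an extra sign. *)
Lemma osign_swap t v w : v != w -> v \notin t -> w \notin t ->
  osign t v * osign (v |: t) w = - (osign t w * osign (w |: t) v).
Proof.
move=> vw vt wt; rewrite !osignU1 // (vlt_total vw).
by case: (vlt w v); rewrite /= ?expr1 ?expr0 ?mul1r ?mulN1r ?mulrN ?opprK mulrC.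
Qed.

Lemma bdryB c1 c2 : bdry (c1 - c2) = bdry c1 - bdry c2.
Proof.
apply/ffunP=> t; rewrite !ffunE -sumrB; apply: eq_bigr => v _.
by rewrite !ffunE mulrBr.
Qed.

Lemma bdryD c1 c2 : bdry (c1 + c2) = bdry c1 + bdry c2.
Proof.
apply/ffunP=> t; rewrite !ffunE -big_split; apply: eq_bigr => v _.
by rewrite !ffunE mulrDr.
Qed.

Lemma bdry_bdry c : bdry (bdry c) = 0.
Proof.
apply/ffunP=> t; rewrite bdryE ffunE.
(* The double boundary is the sum of [G] over ordered pairs of new vertices, and [G] is
   antisymmetric. *)
pose G (v w : T) : F := osign t v * osign (v |: t) w * c (w |: (v |: t)).
pose P (v w : T) := [&& v \notin t, w \notin t & v != w].
have -> : \sum_(v | v \notin t) osign t v * bdry c (v |: t) =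
          \sum_v \sum_(w | P v w) G v w.
  rewrite big_mkcond /=; apply: eq_bigr => v _; rewrite /P.
  case: ifP => vt /=; last by rewrite big_pred0.
  rewrite bdryE big_distrr /=; apply: eq_big => w.
    by rewrite !inE negb_or andbC eq_sym.
  by move=> _; rewrite mulrA.
have GN v w : P v w -> G v w = - G w v.
  by case/and3P=> vt wt vw; rewrite /G (osign_swap vw vt wt) mulNr setUCA.
(* Antisymmetry alone only shows that twice the sum is zero; splitting by [vlt] matches each term
   with its negative in every characteristic. *)
pose H1 := \sum_v \sum_(w | P v w && vlt v w) G v w.
have -> : \sum_v \sum_(w | P v w) G v w =
    H1 + \sum_v \sum_(w | P v w && vlt w v) G v w.
  rewrite -big_split; apply: eq_bigr => v _.
  rewrite (bigID (vlt v)) /=; congr (_ + _); apply: eq_bigl => w.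
  case Pvw : (P v w) => //=; case/and3P: Pvw => _ _ vw.
  by rewrite (vlt_total vw) negbK.
rewrite [X in _ + X](exchange_big_dep xpredT) //= -big_split big1 //= => v _.
rewrite [X in _ + X](eq_bigr (fun w => - G v w)) => [|w /andP [Pwv _]];
  last exact: GN.
rewrite /= sumrN; apply/eqP; rewrite addr_eq0 opprK; apply/eqP/eq_bigl => w.
by rewrite /P eq_sym andbCA.
Qed.

Lemma chain_on_bdry D k c :
  downclosed D -> chain_on D k.+1 c -> chain_on D k (bdry c).
Proof.
move=> dD cD t; rewrite bdryE => nz.
have [v vt /cD /andP [vD /eqP vk]] : exists2 v, v \notin t & c (v |: t) != 0.
  apply/exists_inP; apply: contraNT nz => /exists_inPn H.
  by rewrite big1 // => v /H /negbNE/eqP ->; rewrite mulr0.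
rewrite (dD _ _ vD) ?subsetUr //=.
by move: vk; rewrite cardsU1 vt add1n => -[->].
Qed.

Lemma bdry_chain_on0 D c : chain_on D 0 c -> bdry c = 0.
Proof.
move=> cD; apply/ffunP=> t; rewrite bdryE ffunE big1 // => v _.
have [->|/cD /andP [_]] := eqVneq (c (v |: t)) 0; first by rewrite mulr0.
by rewrite cards_eq0 => /eqP/setP/(_ v); rewrite !inE eqxx.
Qed.

Lemma chain_onD D k c1 c2 :
  chain_on D k c1 -> chain_on D k c2 -> chain_on D k (c1 + c2).
Proof.
move=> h1 h2 s; rewrite ffunE => nz.
have [e|/h1 //] := eqVneq (c1 s) 0.
by apply: h2; rewrite e add0r in nz.
Qed.

Lemma chain_onN D k c : chain_on D k c -> chain_on D k (- c).
Proof. by move=> h s; rewrite ffunE oppr_eq0 => /h. Qed.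

Lemma chain_on0 D k : chain_on D k (0 : {ffun {set T} -> F}).
Proof. by move=> s; rewrite ffunE eqxx. Qed.

Lemma chain_onS D D' k c : D \subset D' -> chain_on D k c -> chain_on D' k c.
Proof. by move=> sD h s /h /andP [/(subsetP sD) -> ->]. Qed.

(* Mayer-Vietoris. *)
Lemma rhomology_vanishesU D1 D2 k :
  downclosed D1 -> downclosed D2 ->
  rhomology_vanishes F D1 k -> rhomology_vanishes F D2 k ->
  (forall j, k = j.+1 -> rhomology_vanishes F (D1 :&: D2) j) ->
  rhomology_vanishes F (D1 :|: D2) k.
Proof.
move=> dD1 dD2 v1 v2 v12 c cD c0.
(* [c1] is the part of [c] on [D1]; the remainder [c2] is supported on [D2]. *)
pose c1 : {ffun {set T} -> F} :=
  [ffun s : {set T} => if s \in D1 then c s else 0].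
pose c2 := c - c1.
have cD1 : chain_on D1 k c1.
  move=> s; rewrite ffunE; case: ifP => [sD1 /cD /andP [_ ->] //|].
  by rewrite eqxx.
have cD2 : chain_on D2 k c2.
  move=> s; rewrite !ffunE; case: ifP => [|sD1]; first by rewrite subrr eqxx.
  by rewrite subr0 => /cD; rewrite inE sD1.
have b12 : bdry c2 = - bdry c1 by rewrite bdryB c0 sub0r.
(* The boundaries of [c1] and [c2] are opposite, so [bdry c1] is a cycle of the intersection; for
   [k = 0] it is zero and [e = 0] serves. *)
have [e [eD eb]] : exists e, chain_on (D1 :&: D2) k e /\ bdry e = bdry c1.
  case: k v12 cD1 cD2 {v1 v2 cD} => [|j] v12 cD1 cD2.
    exists 0; split; first exact: chain_on0.
    by rewrite -(subrr 0) bdryB subrr (bdry_chain_on0 cD1).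
  apply: (v12 j) => // [|]; last exact: bdry_bdry.
  move=> s nz; rewrite inE; have /andP [-> ->] := chain_on_bdry dD1 cD1 nz.
  have : bdry c2 s != 0 by rewrite b12 ffunE oppr_eq0.
  by case/(chain_on_bdry dD2 cD2)/andP=> ->.
(* Correcting by [e] makes each part a cycle of its own piece and leaves the sum unchanged. *)
have [] := v1 (c1 - e); first by apply: chain_onD => //; apply: chain_onN;
  apply: chain_onS eD; apply: subsetIl.
  by rewrite bdryB eb subrr.
move=> b1 [b1D b1E].
have [] := v2 (c2 + e); first by apply: chain_onD => //;
  apply: chain_onS eD; apply: subsetIr.
  by rewrite bdryD eb b12 addNr.
move=> b2 [b2D b2E].
exists (b1 + b2); split.
  by apply: chain_onD; [apply: chain_onS b1D|apply: chain_onS b2D];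
    rewrite ?subsetUl ?subsetUr.
by rewrite bdryD b1E b2E addrACA addNr addr0 addrC subrK.
Qed.

(* Coning off a vertex [x] contracts the full simplex. *)
Lemma rhomology_vanishes_powerset s k :
  (0 < k + #|s|)%N -> rhomology_vanishes F (powerset s) k.
Proof.
move=> ks c cD c0; have [s0|[x xs]] := set_0Vmem s.
  (* With [s] empty the only face has cardinality 0 while the hypothesis gives [k > 0], so [c] is
     zero. *)
  exists 0; split; first exact: chain_on0.
  rewrite -(subrr 0) bdryB subrr; apply/ffunP=> t; rewrite ffunE.
  apply/esym/eqP; apply: contraTT ks => /cD; rewrite s0 powersetE subset0.
  by case/andP=> /eqP ->; rewrite cards0 addn0 => /eqP <-.
(* The cone of [c] from [x], signed so that deleting [x] returns [c] with coefficient one. *)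
pose b : {ffun {set T} -> F} :=
  [ffun t : {set T} => if x \in t then osign (t :\ x) x * c (t :\ x) else 0].
have bU (t : {set T}) : x \notin t -> b (x |: t) = osign t x * c t.
  by move=> xt; rewrite ffunE setU11 setU1K.
exists b; split.
  move=> t; rewrite ffunE; case: ifP => [xt|]; last by rewrite eqxx.
  have [->|/cD] := eqVneq (c (t :\ x)) 0; first by rewrite mulr0 eqxx.
  rewrite !powersetE => /andP [st /eqP <-] _.
  by rewrite (cardsD1 x t) xt add1n eqxx andbT -(setD1K xt) subUset sub1set xs.
apply/ffunP=> t; rewrite bdryE; have [xt|xt] := boolP (x \in t); last first.
  rewrite (bigD1 x) //= bU // mulrA osign_sqr mul1r big1 ?addr0 // => v.
  case/andP=> vt vx; rewrite ffunE !inE eq_sym (negbTE vx) (negbTE xt).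
  by rewrite mulr0.
have xt' : x \notin t :\ x by rewrite !inE eqxx.
move: (t :\ x) xt' (setD1K xt) => u xu <- {t xt}.
(* On a face containing [x], the value of [c] is read off from the cycle condition at the face
   without [x]. *)
have := congr1 (fun f : {ffun {set T} -> F} => f u) c0.
rewrite bdryE ffunE (bigD1 x) //= => /eqP; rewrite addr_eq0 => /eqP E.
rewrite -[RHS]mul1r -(osign_sqr u x) -mulrA E mulrN -mulNr big_distrr /=.
apply: eq_big => [v|v].
  by rewrite !inE negb_or andbC.
rewrite !inE negb_or => /andP [vx vu].
rewrite setUCA bU; last by rewrite !inE negb_or eq_sym vx.
rewrite !mulrA; congr (_ * _).
rewrite !osignU1 // (vlt_total vx).
by case: (vlt x v); rewrite /= ?expr1 ?expr0 ?mul1r ?mulN1r ?mulrN ?mulNr mulrC.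
Qed.

End Homology.

(** * Constructible complexes are Cohen-Macaulay *)

(** The index is the dimension plus one; index 0 is reached only by the complex whose sole face is
    empty. *)
Inductive constructible (T : finType) : nat -> {set {set T}} -> Prop :=
| constructible_simplex (s : {set T}) : constructible #|s| (powerset s)
| constructibleU d (D1 D2 : {set {set T}}) :
    constructible d.+1 D1 -> constructible d.+1 D2 ->
    constructible d (D1 :&: D2) -> constructible d.+1 (D1 :|: D2).

Section Constructible.
Variable T : finType.
Implicit Types (D : {set {set T}}) (s t : {set T}).

Lemma constructible_downclosed d D : constructible d D -> downclosed D.
Proof.
elim=> {d D} [s|d D1 D2 _ h1 _ h2 _ _] u t.
  by rewrite !powersetE => us tu; apply: subset_trans us.
rewrite !inE => /orP [uD|uD] tu; first by rewrite (h1 _ _ uD tu).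
by rewrite (h2 _ _ uD tu) orbT.
Qed.

Lemma constructible_card d D s : constructible d D -> s \in D -> #|s| <= d.
Proof.
move=> h; elim: h s => {d D} [s|d D1 D2 _ h1 _ h2 _ _] t.
  by rewrite powersetE; apply: subset_leq_card.
by rewrite inE => /orP [/h1|/h2].
Qed.

Lemma constructible_cdim d D : constructible d D -> cdim D = d.
Proof.
move=> h; apply/eqP; rewrite eqn_leq; apply/andP; split.
  by apply/bigmax_leqP => s; apply: constructible_card h.
suff [s sD <-] : exists2 s, s \in D & #|s| = d by apply: leq_bigmax_cond.
elim: h => {d D} [s|d D1 D2 _ [s sD sd] _ _ _ _].
  by exists s; rewrite // powersetE.
by exists s; rewrite // inE sD.
Qed.

Lemma link_downclosed D s : downclosed D -> downclosed (link D s).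
Proof.
move=> dD g h; rewrite !inE => /and3P [gD gs gsD] hg.
rewrite (dD _ _ gD hg) (disjointWl hg gs) /=.
by apply: dD gsD _; apply: setSU.
Qed.

Lemma linkI D1 D2 s : link (D1 :&: D2) s = link D1 s :&: link D2 s.
Proof.
apply/setP=> g; rewrite !inE.
by case: (g \in D1); case: (g \in D2); case: [disjoint _ & _];
  case: (_ \in D1); case: (_ \in D2).
Qed.

Lemma linkU D1 D2 s : downclosed D1 -> downclosed D2 ->
  link (D1 :|: D2) s = link D1 s :|: link D2 s.
Proof.
move=> d1 d2; apply/setP=> g; rewrite !inE.
have := d1 (g :|: s) g; have := d2 (g :|: s) g; rewrite subsetUl.
case: (g \in D1); case: (g \in D2); case: [disjoint _ & _] => //=;
  case: (_ \in D1); case: (_ \in D2) => //= h1 h2; by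
  [have := h1 isT isT | have := h2 isT isT].
Qed.

Lemma link_notin D s : downclosed D -> s \notin D -> link D s = set0.
Proof.
move=> dD sD; apply/setP=> g; rewrite !inE; apply/negP => /and3P [_ _ h].
by case/negP: sD; apply: dD h _; apply: subsetUr.
Qed.

Lemma link_powerset s t :
  t \subset s -> link (powerset s) t = powerset (s :\: t).
Proof.
move=> ts; apply/setP=> g; rewrite !inE subsetD subUset ts andbT.
by case: (g \subset s); rewrite //= andbT.
Qed.

(** Links commute with unions and intersections, so Mayer-Vietoris applies; passing to the
    intersection lowers both [d] and [k] by one, which preserves the inequality. In a simplex the
    link is the simplex on the remaining vertices, acyclic unless none remain and [k = 0], the
    excluded degree. *)
Lemma constructible_link_acyclic (F : fieldType) d D s k :
  constructible d D -> s \in D -> k + #|s| != d ->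
  rhomology_vanishes F (link D s) k.
Proof.
move=> h; elim: h s k => {d D} [t|d D1 D2 c1 h1 c2 h2 c12 h12] s k.
  rewrite powersetE => st ks; rewrite link_powerset //.
  apply: rhomology_vanishes_powerset; rewrite lt0n; apply: contraNneq ks.
  move/eqP; rewrite addn_eq0 => /andP [/eqP -> ts]; rewrite add0n eqn_leq.
  rewrite subset_leq_card // subset_leq_card // -setD_eq0.
  by rewrite -cards_eq0.
have d1 := constructible_downclosed c1; have d2 := constructible_downclosed c2.
rewrite linkU // inE => sD ks.
(* A face missing from one piece has an empty link there, which leaves the link in the other
   piece. *)
have [s1|s1] := boolP (s \in D1); last first.
  rewrite (link_notin d1 s1) set0U; apply: h2 => //.
  by rewrite (negbTE s1) in sD.
have [s2|s2] := boolP (s \in D2); last first.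
  by rewrite (link_notin d2 s2) setU0; apply: h1.
apply: rhomology_vanishesU; [exact: link_downclosed..|exact: h1|exact: h2|].
move=> j kj; rewrite -linkI; apply: h12; first by rewrite inE s1.
by rewrite kj addSn eqSS in ks.
Qed.

Lemma constructible_CohenMacaulay (F : fieldType) d D :
  constructible d D -> CohenMacaulay F D.
Proof.
move=> h s sD k; rewrite (constructible_cdim h) => ks.
apply: constructible_link_acyclic h sD _; apply: contraNneq ks => <-.
by rewrite addnK.
Qed.

Lemma constructible_imset (T' : finType) (f : T -> T') d D :
  injective f -> constructible d D ->
  constructible d [set f @: (s : {set T}) | s in D].
Proof.
move=> f_inj; elim=> {d D} [s|d D1 D2 _ h1 _ h2 _ h12].
  rewrite -(card_imset _ f_inj) (_ : imset _ _ = powerset (f @: s)).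
    exact: constructible_simplex.
  apply/setP=> t; rewrite powersetE; apply/imsetP/idP => [[u]|ts].
    by rewrite powersetE => us ->; apply: imsetS.
  exists (f @^-1: t).
    rewrite powersetE; apply/subsetP => x; rewrite inE => /(subsetP ts).
    by rewrite mem_imset.
  apply/setP=> y; apply/idP/imsetP => [yt|[x]]; last by rewrite inE => ? ->.
  by have /imsetP [x _ e] := subsetP ts _ yt; exists x; rewrite // inE -e.
rewrite imsetU; apply: constructibleU => //.
by rewrite -imsetI // => x y _ _; apply: imset_inj.
Qed.

End Constructible.

(** * Complexes given by lists of generators, and shellings *)

Definition simplex n (f : seq nat) : {set 'I_n} := [set x : 'I_n | val x \in f].

Definition cplx n (L : seq (seq nat)) : {set {set 'I_n}} :=
  [set s : {set 'I_n} | has (fun f => s \subset simplex n f) L].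

Definition subl (f g : seq nat) := all (mem g) f.

(** Generators for the restriction to the vertices in [f], which is either a new facet or the whole
    vertex list of A^*; they may repeat or be nested. *)
Definition meets (f : seq nat) (L : seq (seq nat)) :=
  [seq [seq x <- f | x \in g] | g <- L].

(* [shelling n d L]: the reverse of [L] is a shelling order; each facet meets
   the earlier ones in a nonempty set of its ridges, which is shelled again. *)
Fixpoint shelling n d : seq (seq nat) -> bool :=
  fix shelling_d L :=
    if L is f :: L' then
      [&& uniq f, all (gtn n) f, size f == d &
        (L' == [::]) ||
        (if d is e.+1 then
           let J := undup [seq a <- meets f L' | size a == e] in
           [&& shelling_d L', all (fun a => has (subl a) J) (meets f L') &
               shelling n e J]
         else false)]
    else false.

Section Simplices.
Variable n : nat.
Implicit Types (f g : seq nat) (L : seq (seq nat)).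

Lemma simplexS f g : subl f g -> simplex n f \subset simplex n g.
Proof. by move/allP=> fg; apply/subsetP => x; rewrite !inE; apply: fg. Qed.

Lemma simplex_filter (p : pred nat) f :
  simplex n [seq x <- f | p x] = [set x in simplex n f | p (val x)].
Proof. by apply/setP=> x; rewrite !inE mem_filter andbC. Qed.

Lemma sub_simplex f g : all (gtn n) f ->
  (simplex n f \subset simplex n g) = subl f g.
Proof.
move=> /allP fn; apply/idP/idP=> [/subsetP fg|]; last exact: simplexS.
apply/allP=> x xf; have := fg (Ordinal (fn x xf)); rewrite !inE /=.
by move/(_ xf).
Qed.

Lemma card_simplex f : uniq f -> all (gtn n) f -> #|simplex n f| = size f.
Proof.
move=> fu /allP fn; rewrite cardE -(size_map val); apply/perm_size/uniq_perm.
- by rewrite map_inj_uniq ?enum_uniq //; apply: val_inj.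
- exact: fu.
move=> x; apply/mapP/idP=> [[y]|xf]; first by rewrite mem_enum inE => ? ->.
by exists (Ordinal (fn x xf)); rewrite // mem_enum inE.
Qed.

Lemma cplx_cons f L : cplx n (f :: L) = cplx n L :|: powerset (simplex n f).
Proof. by apply/setP=> s; rewrite !inE /= orbC. Qed.

Lemma cplx1 f : cplx n [:: f] = powerset (simplex n f).
Proof. by apply/setP=> s; rewrite !inE /= orbF. Qed.

Lemma cplx_sub L L' :
  all (fun a => has (subl a) L') L -> cplx n L \subset cplx n L'.
Proof.
move=> /allP LL; apply/subsetP => s; rewrite !inE.
case/hasP=> [a /LL /hasP [b bL ab] sa].
by apply/hasP; exists b => //; apply: subset_trans (simplexS ab).
Qed.

Lemma cplx_eq L L' :
  all (fun a => has (subl a) L') L -> all (fun a => has (subl a) L) L' ->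
  cplx n L = cplx n L'.
Proof. by move=> h h'; apply/eqP; rewrite eqEsubset !cplx_sub. Qed.

Lemma cplx_meets f L : cplx n L :&: powerset (simplex n f) = cplx n (meets f L).
Proof.
apply/setP=> s; rewrite !inE /meets has_map; apply/andP/hasP.
  case=> /hasP [g gL sg] sf; exists g => //=; rewrite simplex_filter.
  apply/subsetP=> x xs; move/subsetP: sg => /(_ x xs).
  by move/subsetP: sf => /(_ x xs); rewrite !inE => -> ->.
case=> g gL /= /subsetP sfg; split; last first.
  by apply/subsetP => x /sfg; rewrite simplex_filter !inE => /andP [].
apply/hasP; exists g => //; apply/subsetP => x /sfg.
by rewrite simplex_filter !inE => /andP [].
Qed.

Lemma shelling_constructible d L : shelling n d L -> constructible d (cplx n L).
Proof.
elim: d L => [|d IHd]; elim=> [|f L IHL] //= /and4P [fu fn /eqP fd].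
  rewrite orbF => /eqP ->; rewrite cplx1.
  by rewrite -fd -(card_simplex fu fn); apply: constructible_simplex.
case: eqP => [->|_] /=.
  rewrite cplx1.
  by rewrite -fd -(card_simplex fu fn) => _; apply: constructible_simplex.
case/and3P=> /IHL cL mJ /IHd cJ; rewrite cplx_cons; apply: constructibleU => //.
  by rewrite -fd -(card_simplex fu fn); apply: constructible_simplex.
(* The ridges in [J] are themselves traces on [f] and contain all the others, so they generate the
   whole intersection. *)
rewrite cplx_meets; move: cJ; congr (constructible _ _); apply: cplx_eq => //.
apply/allP => a; rewrite mem_undup mem_filter => /andP [_ aM].
by apply/hasP; exists a => //; apply/allP.
Qed.

End Simplices.

(** * Explicit shellings of Q^* and A^* *)

(** Listed in shelling order; [rev] is there because [shelling] removes the last facet first. *)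
Definition Qshelling : seq (seq nat) :=
  rev [:: [:: 0; 1; 2; 3]; [:: 0; 1; 2; 5]; [:: 0; 2; 5; 12]; [:: 1; 2; 3; 10];
     [:: 1; 2; 5; 6]; [:: 1; 2; 6; 9]; [:: 1; 2; 9; 10]; [:: 1; 3; 4; 10];
     [:: 1; 3; 4; 7]; [:: 1; 4; 9; 10]; [:: 1; 4; 8; 9]; [:: 1; 5; 6; 11];
     [:: 1; 6; 9; 11]; [:: 1; 8; 9; 11]; [:: 1; 5; 8; 11]; [:: 1; 4; 5; 8];
     [:: 1; 4; 5; 7]; [:: 2; 5; 6; 12]; [:: 4; 5; 7; 13]; [:: 4; 5; 8; 13]].

Definition Ashelling : seq (seq nat) :=
  rev [:: [:: 0; 2; 3]; [:: 0; 2; 12]; [:: 2; 3; 10]; [:: 2; 6; 12];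
     [:: 3; 4; 10]; [:: 3; 4; 7]; [:: 4; 7; 13]; [:: 4; 8; 13]].

Definition Averts : seq nat := [:: 0;2;3;4;6;7;8;10;12;13].

Lemma constructible_Qstar : constructible 4 Qstar.
Proof.
(* The shelling test and the comparison of the two facet lists are decided by evaluation. *)
rewrite (_ : Qstar = cplx 14 Qshelling); first exact: shelling_constructible.
exact: (@cplx_eq 14 Qfacets).
Qed.

Lemma AstarE : Astar = cplx 14 (meets Averts Qfacets).
Proof.
by rewrite -cplx_meets; apply/setP=> s; rewrite !inE.
Qed.

Lemma constructible_Astar : constructible 3 Astar.
Proof.
rewrite AstarE (_ : cplx 14 _ = cplx 14 Ashelling).
  exact: shelling_constructible.
exact: cplx_eq.
Qed.

(** * Gluing copies of Q^* along A^* *)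

Section Gluing.
Variable N : nat.
Implicit Types (i j : 'I_N.+1) (s t : {set 'I_14}).

Lemma glue_vertex_fst i v : (glue_vertex i v).1 = v.
Proof. by rewrite /glue_vertex; case: ifP. Qed.

Lemma glue_vertex_inj i : injective (@glue_vertex N i).
Proof. by move=> u v /(congr1 fst); rewrite !glue_vertex_fst. Qed.

Lemma glue_vertex_eq i j u v :
  glue_vertex i u = glue_vertex j v -> u \notin Avert -> i = j.
Proof.
move=> e uA; have uv := congr1 fst e; rewrite !glue_vertex_fst in uv.
by move: e; rewrite -uv /glue_vertex (negbTE uA) => -[].
Qed.

Lemma glue_vertex_Avert i j s : s \subset Avert ->
  glue_vertex i @: s = glue_vertex j @: s.
Proof.
move/subsetP=> sA; apply: eq_in_imset => x /sA.
by rewrite /glue_vertex => ->.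
Qed.

(** A vertex outside A^* carries its copy index, so a face having one determines its copy. *)
Lemma glue_subset_eq i j s t :
  glue_vertex i @: s \subset glue_vertex j @: t -> ~~ (s \subset Avert) ->
  i = j.
Proof.
move/subsetP=> st /subsetPn [x xs xA].
have /st/imsetP [y _ /glue_vertex_eq e] := imset_f (glue_vertex i) xs.
exact: e.
Qed.

Lemma glue_subset i s t :
  (glue_vertex i @: s \subset glue_vertex i @: t) = (s \subset t).
Proof.
apply/idP/idP => [/subsetP st|]; last exact: imsetS.
apply/subsetP => x /(imset_f (glue_vertex i)) /st.
by rewrite mem_imset //; apply: glue_vertex_inj.
Qed.

Definition copy i (D : {set {set 'I_14}}) :=
  [set glue_vertex i @: (s : {set 'I_14}) | s in D].

Lemma mem_copy i D s : (glue_vertex i @: s \in copy i D) = (s \in D).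
Proof. by rewrite mem_imset //; apply/imset_inj/glue_vertex_inj. Qed.

(** A common face has no vertex outside A^*, and faces of A^* are the same in all copies; the index
    [ord0] is a mere representative. *)
Lemma copyI i j : i != j -> copy i Qstar :&: copy j Qstar = copy ord0 Astar.
Proof.
move=> ij; apply/setP=> S; rewrite inE; apply/andP/imsetP.
  case=> /imsetP [s sQ ->] /imsetP [t _ e]; exists s.
    rewrite inE sQ /=; apply: contraNT ij => sA.
    by apply/eqP; apply: (glue_subset_eq (s := s) (t := t)); rewrite // e.
  apply: glue_vertex_Avert; apply: contraNT ij => sA.
  by apply/eqP; apply: (glue_subset_eq (s := s) (t := t)); rewrite // e.
case=> s; rewrite inE => /andP [sQ sA] ->.
by rewrite {1}(glue_vertex_Avert ord0 i sA)
  (glue_vertex_Avert ord0 j sA) !mem_copy.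
Qed.

Lemma Cglue_copies : Cglue N = \bigcup_i copy i Qstar.
Proof.
apply/setP=> S; rewrite inE; apply/existsP/bigcupP.
  by case=> i /exists_inP [s sQ /eqP ->]; exists i; rewrite // mem_copy.
by case=> i _ /imsetP [s sQ ->]; exists i; apply/exists_inP; exists s.
Qed.

Lemma constructible_Cglue : constructible 4 (Cglue N).
Proof.
rewrite Cglue_copies.
have cQ i : constructible 4 (copy i Qstar).
  exact: constructible_imset (@glue_vertex_inj i) constructible_Qstar.
(* Copies are added one at a time, [m] being the last index, so [m = 0] is a single copy. Each new
   copy meets every earlier one in the same A^*. *)
suff H m : m <= N -> constructible 4 (\bigcup_(i < N.+1 | i <= m) copy i Qstar).
  rewrite (eq_bigl (fun i : 'I_N.+1 => i <= N)); first exact: H.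
  by move=> i; rewrite -ltnS ltn_ord.
elim: m => [|m IHm] mN.
  rewrite (eq_bigl (pred1 ord0)) ?big_pred1_eq //.
  by move=> i; rewrite leqn0 /= -val_eqE.
pose j : 'I_N.+1 := Ordinal (mN : m.+1 < N.+1).
rewrite (bigD1 j) //= setUC.
rewrite (eq_bigl (fun i : 'I_N.+1 => i <= m)); last first.
  by move=> i; rewrite -val_eqE /= andbC -(ltnS i m) (ltn_neqAle i m.+1).
apply: constructibleU => //; first exact/IHm/ltnW.
rewrite big_distrl /=.
rewrite (eq_bigr (fun=> copy ord0 Astar)) => [|i im]; last first.
  by apply: copyI; rewrite -val_eqE /= neq_ltn ltnS im.
rewrite (_ : \bigcup_(i | _) _ = copy ord0 Astar); last first.
  apply/eqP; rewrite eqEsubset; apply/andP; split; first exact/bigcupsP.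
  exact: (bigcup_sup ord0).
exact: constructible_imset (@glue_vertex_inj ord0) constructible_Astar.
Qed.

(** * Balancedness *)

Definition Qcolor : seq nat := [:: 0; 1; 2; 3; 2; 3; 0; 0; 0; 3; 0; 2; 1; 1].

(** [Qcolor] is a proper colouring of the graph of Q^*. Colours depend only on the underlying
    vertex, and every edge lies in one facet of one copy, so checking the facets of Q^* suffices. *)
Lemma balanced_Cglue : balanced (Cglue N).
Proof.
rewrite /balanced (constructible_cdim constructible_Cglue).
have Q4 (v : 'I_14) : nth 0 Qcolor v < 4.
  by apply: (allP (isT : all (gtn 4) Qcolor)); rewrite mem_nth ?ltn_ord.
exists (fun v => Ordinal (Q4 v.1)) => u v uv.
rewrite Cglue_copies => /bigcupP [i _ /imsetP [s sQ e]].
have [x xs ux] : exists2 x, x \in s & u = glue_vertex i x.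
  by apply/imsetP; rewrite -e !inE eqxx.
have [y ys vy] : exists2 y, y \in s & v = glue_vertex i y.
  by apply/imsetP; rewrite -e !inE eqxx orbT.
have {uv} xy : x != y by apply: contraNneq uv => xy; rewrite ux vy xy.
rewrite -val_eqE ux vy /= !glue_vertex_fst.
move: sQ; rewrite inE => /hasP [f fQ /subsetP sf].
have := sf _ xs; have := sf _ ys; rewrite !inE => yf xf.
have /allP/(_ f fQ)/allrelP/(_ _ _ xf yf) :
    all (fun g => all2rel
      (fun a b => (a == b) || (nth 0 Qcolor a != nth 0 Qcolor b)) g) Qfacets.
  by [].
by rewrite [_ == _](negbTE xy).
Qed.

End Gluing.

(** * Excluding exact covers by repeated filtering *)

Section ExactCover.
Variables (I G : eqType) (compat : rel I) (covers : I -> G -> bool).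
Variable C : seq G.

(** Binding [coverers] outside the filter lets it be evaluated once per round. *)
Definition refine (L : seq I) : seq I :=
  let coverers := [seq [seq b <- L | covers b g] | g <- C] in
  [seq a <- L | all (has (compat a)) coverers].

(** [P] is a hypothetical exact cover: each [g] is covered by a member of [P] that has survived so
    far and is compatible with [a], so no [a] in [P] is ever discarded. *)
Lemma iter_refine (P L : seq I) m :
  {in P &, forall a b, compat a b} ->
  (forall g, g \in C -> has (covers^~ g) P) ->
  {subset P <= L} -> {subset P <= iter m refine L}.
Proof.
move=> Pcompat Pcovers PL; elim: m => //= m IHm a aP.
rewrite mem_filter IHm // andbT all_map.
apply/allP => g /Pcovers /hasP [b bP bg].
apply/hasP; exists b; last exact: Pcompat.
by rewrite mem_filter bg IHm.
Qed.

End ExactCover.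

(** * The faces of Q^* outside A^* have no partition; counting the faces of A^* *)

(** The order of [f] is kept. As the facets are listed increasingly, a face of several facets is
    always the same list, so [undup] merges its occurrences. *)
Fixpoint sublists (f : seq nat) : seq (seq nat) :=
  if f is x :: f' then [seq x :: g | g <- sublists f'] ++ sublists f'
  else [:: [::]].

Lemma filter_sublists (p : pred nat) f : [seq x <- f | p x] \in sublists f.
Proof.
elim: f => //= x f IHf; rewrite mem_cat; case: (p x); last by rewrite IHf orbT.
by rewrite map_f.
Qed.

Lemma sublists_sub f g : g \in sublists f -> subl g f.
Proof.
elim: f g => [|x f IHf] g /=; first by rewrite inE => /eqP ->.
rewrite mem_cat => /orP [/mapP [h /IHf hf ->]|/IHf hf]; rewrite /subl /=.
  rewrite inE eqxx; apply/allP => y /(allP hf) /= yf.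
  by rewrite inE yf orbT.
by apply/allP => y /(allP hf) /= yf; rewrite inE yf orbT.
Qed.

Definition meets_outside (g : seq nat) := ~~ subl g Averts.

Definition relative_faces : seq (seq nat) :=
  undup [seq g <- flatten [seq sublists f | f <- Qfacets] | meets_outside g].

(* [(g, f)] encodes the Boolean interval [g, f]. *)
Definition relative_intervals : seq (seq nat * seq nat) :=
  flatten [seq [seq (g, f) | g <- sublists f & meets_outside g] | f <- Qfacets].

Definition in_interval (a : seq nat * seq nat) g := subl a.1 g && subl g a.2.

(** Two intervals meet exactly when the union of their bottoms lies in both tops, that is, when each
    bottom lies in the other top. *)
Definition disjoint_or_eq (a b : seq nat * seq nat) :=
  (a == b) || ~~ (subl a.1 b.2 && subl b.1 a.2).

Lemma refine_relative_intervals :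
  iter 4 (refine disjoint_or_eq in_interval relative_faces) relative_intervals
    = [::].
Proof. by vm_compute. Qed.

(** [r f] is the bottom of the interval with top [f]. These intervals form a nonempty family
    surviving every refinement, whereas evaluation leaves none. *)
Lemma no_relative_partition (r : seq nat -> seq nat) :
  {in Qfacets, forall f, (r f \in sublists f) && meets_outside (r f)} ->
  {in Qfacets &, forall f1 f2, subl (r f1) f2 -> subl (r f2) f1 -> f1 = f2} ->
  {in relative_faces, forall g,
    exists2 f, f \in Qfacets & subl (r f) g && subl g f} -> False.
Proof.
move=> r_sub r_disj r_cov.
pose P := [seq (r f, f) | f <- Qfacets].
have : {subset P <= [::]}.
  rewrite -refine_relative_intervals; apply: iter_refine.
  - move=> _ _ /mapP [f1 f1Q ->] /mapP [f2 f2Q ->]; rewrite /disjoint_or_eq /=.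
    case: andP => [[h1 h2]|]; last by rewrite orbT.
    by rewrite (r_disj f1 f2 f1Q f2Q h1 h2) eqxx.
  - move=> g /r_cov [f fQ fg]; apply/hasP; exists (r f, f) => //.
    by apply: map_f.
  move=> _ /mapP [f fQ ->]; apply/flattenP.
  exists [seq (g, f) | g <- sublists f & meets_outside g].
    exact: (map_f (fun f => [seq (g, f) | g <- sublists f & meets_outside g])).
  apply: (map_f (fun g => (g, f))).
  by rewrite mem_filter andbC r_sub.
by move/(_ _ (mem_head _ _)).
Qed.

Lemma card_Astar : #|Astar| <= 36.
Proof.
have [L <- LP] : exists2 L, size L = 36 &
    {subset flatten [seq sublists f | f <- meets Averts Qfacets] <= L}.
  exists (undup (flatten [seq sublists f | f <- meets Averts Qfacets])) => //.
  by move=> f; rewrite mem_undup.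
rewrite -(size_map (simplex 14)).
apply: (leq_trans _ (card_size [seq simplex 14 f | f <- L])).
apply/subset_leq_card/subsetP => s; rewrite AstarE inE => /hasP [f fL sf].
(* A face inside [f] is recovered from the sublist of [f] that it selects; [inord] is faithful on
   labels below 14. *)
have -> : s = simplex 14 [seq x <- f | inord x \in s].
  rewrite simplex_filter; apply/setP=> x; rewrite inE inord_val.
  by case xs: (x \in s); rewrite ?andbF // (subsetP sf).
apply/map_f/LP/flattenP.
by exists (sublists f); [apply: map_f|apply: filter_sublists].
Qed.

Lemma Qfacets_bound f : f \in Qfacets -> all (gtn 14) f.
Proof. exact: (allP (isT : all (all (gtn 14)) Qfacets)). Qed.

Lemma Qfacets_antichain : {in Qfacets &, forall f g, subl f g -> f = g}.
Proof.
move=> f g fQ gQ fg.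
have /allrelP/(_ _ _ fQ gQ) :
    all2rel (fun a b => subl a b ==> (a == b)) Qfacets by [].
by rewrite fg => /eqP.
Qed.

Lemma simplex_Avert f : all (gtn 14) f ->
  (simplex 14 f \subset Avert) = subl f Averts.
Proof. exact: (@sub_simplex 14 f Averts). Qed.

Lemma Qfacets_outside f : f \in Qfacets -> ~~ (simplex 14 f \subset Avert).
Proof.
move=> fQ; rewrite simplex_Avert ?Qfacets_bound //.
exact: (allP (isT : all meets_outside Qfacets)).
Qed.

(** * Facets and partitionings of the glued complex *)

Section Partition.
Variable N : nat.
Implicit Types (i j : 'I_N.+1).

Definition glued_simplex i f := glue_vertex i @: simplex 14 f.

Lemma mem_Cglue i f (s : {set 'I_14}) :
  f \in Qfacets -> s \subset simplex 14 f ->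
  glue_vertex i @: s \in Cglue N.
Proof.
move=> fQ sf; rewrite Cglue_copies; apply/bigcupP; exists i => //.
rewrite mem_copy.
by rewrite inE; apply/hasP; exists f.
Qed.

Lemma Cglue_sub_glued_simplex S : S \in Cglue N ->
  exists i, exists2 f, f \in Qfacets & S \subset glued_simplex i f.
Proof.
rewrite Cglue_copies => /bigcupP [i _ /imsetP [s]].
rewrite inE => /hasP [f fQ sf] ->.
by exists i, f => //; apply: imsetS.
Qed.

(** Facets of Q^* have a vertex outside A^*, so a larger face would lie in a simplex of the same
    copy, where the facets form an antichain. *)
Lemma facet_glued_simplex i f : f \in Qfacets ->
  facet (Cglue N) (glued_simplex i f).
Proof.
move=> fQ; rewrite /facet (mem_Cglue _ fQ) //=.
apply/forall_inP => S /Cglue_sub_glued_simplex [j [g gQ Sg]].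
apply/implyP=> fS; have fg := subset_trans fS Sg.
have ij := glue_subset_eq fg (Qfacets_outside fQ); rewrite -ij in Sg fg.
rewrite glue_subset sub_simplex ?Qfacets_bound // in fg.
by rewrite eqEsubset fS (Qfacets_antichain fQ gQ fg) Sg.
Qed.

Lemma facet_CglueP S : facet (Cglue N) S ->
  exists i, exists2 f, f \in Qfacets & S = glued_simplex i f.
Proof.
case/andP=> /Cglue_sub_glued_simplex [i [f fQ Sf]] /forall_inP/(_ _ _)/implyP H.
exists i; exists f => //; apply/esym/eqP/H => //.
exact: mem_Cglue fQ _.
Qed.

Lemma glued_simplex_inj i j f g : f \in Qfacets -> g \in Qfacets ->
  glued_simplex i f = glued_simplex j g -> i = j /\ f = g.
Proof.
move=> fQ gQ e.
have fg : glued_simplex i f \subset glued_simplex j g by rewrite e.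
have ij := glue_subset_eq fg (Qfacets_outside fQ); split=> //.
rewrite -ij glue_subset sub_simplex ?Qfacets_bound // in fg.
exact: Qfacets_antichain.
Qed.

(* Two copies cannot use the same bottom face in [A^*], so with more copies than
   faces of [A^*] some copy has all its intervals outside [A^*]. *)
Lemma copy_avoiding_Astar (R : {set 'I_14 * 'I_N.+1} -> {set 'I_14 * 'I_N.+1}) :
  36 <= N ->
  (forall f, facet (Cglue N) f -> R f \subset f) ->
  (forall g, g \in Cglue N ->
     exists! f, facet (Cglue N) f /\ R f \subset g /\ g \subset f) ->
  exists i,
    {in Qfacets, forall f, R (glued_simplex i f) \notin copy ord0 Astar}.
Proof.
move=> N36 Rsub Rpart.
pose good i :=
  all (fun f => R (glued_simplex i f) \notin copy ord0 Astar) Qfacets.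
have [/existsP [i /allP gi]|] := boolP [exists i, good i]; first by exists i.
rewrite negb_exists => /forallP bad.
have {}bad i : {f | f \in Qfacets & R (glued_simplex i f) \in copy ord0 Astar}.
  apply: sig2W; have /allPn [f fQ] := bad i; rewrite negbK => fA; by exists f.
pose h i := s2val (bad i).
have hQ i : h i \in Qfacets by rewrite /h; case: (bad i).
have hA i : R (glued_simplex i (h i)) \in copy ord0 Astar.
  by rewrite /h; case: (bad i).
have h_inj : injective (fun i => R (glued_simplex i (h i))).
  (* A common bottom is a face lying in both intervals; uniqueness identifies the tops, and a top
     determines its copy. *)
  move=> i j e; pose S := R (glued_simplex i (h i)).
  have Sf k : R (glued_simplex k (h k)) \subset glued_simplex k (h k).
    exact/Rsub/facet_glued_simplex.
  have SC : S \in Cglue N.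
    apply: (constructible_downclosed (constructible_Cglue N)) (Sf i).
    by apply: mem_Cglue (hQ i) _.
  have [F [_ FU]] := Rpart S SC.
  have Fi : F = glued_simplex i (h i).
    by apply: FU; split; [exact: facet_glued_simplex|split; last exact: Sf].
  have Fj : F = glued_simplex j (h j).
    apply: FU; split; [exact: facet_glued_simplex|].
    by rewrite /S; cbn in e; rewrite e; split; last exact: Sf.
  by have [] := glued_simplex_inj (hQ i) (hQ j) (etrans (esym Fi) Fj).
(* There are [N.+1], hence at least 37, copies for at most 36 faces of A^*. *)
have : #|'I_N.+1| <= #|copy (ord0 : 'I_N.+1) Astar|.
  rewrite -(card_imset predT h_inj); apply/subset_leq_card/subsetP.
  by move=> _ /imsetP [i _ ->]; apply: hA.
rewrite card_ord => /leq_trans/(_ (leq_imset_card _ _)).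
move/leq_trans/(_ card_Astar).
by rewrite ltnNge N36.
Qed.

Lemma not_partitionable_Cglue : 36 <= N -> ~ partitionable (Cglue N).
Proof.
move=> N36 [R [Rsub Rpart]].
have [i Ri] := copy_avoiding_Astar N36 Rsub Rpart.
(* The bottom of the interval below [f] in copy [i], pulled back to a sublist of [f]. *)
pose r f := [seq x <- f | glue_vertex i (inord x) \in R (glued_simplex i f)].
have rE f : f \in Qfacets ->
    R (glued_simplex i f) = glue_vertex i @: simplex 14 (r f).
  move=> fQ; apply/setP=> v; apply/idP/imsetP => [vR|[x]].
    have /imsetP [x xf vx] := subsetP (Rsub _ (facet_glued_simplex i fQ)) _ vR.
    by exists x; rewrite // simplex_filter inE xf inord_val -vx.
  by rewrite simplex_filter inE inord_val => /andP [_ xR] ->.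
have rf f : subl (r f) f by exact/sublists_sub/filter_sublists.
have bound f g : f \in Qfacets -> subl g f -> all (gtn 14) g.
  by move=> /Qfacets_bound/allP fn /allP gf; apply/allP => x /gf /fn.
apply: (no_relative_partition (r := r)).
- move=> f fQ; rewrite filter_sublists /=.
  have := Ri f fQ; rewrite rE //; apply: contraNN => rA.
  rewrite (glue_vertex_Avert i ord0) ?simplex_Avert ?(bound f) //.
  rewrite mem_copy !inE simplex_Avert ?(bound f) // rA andbT.
  by apply/hasP; exists f => //; apply: simplexS.
- move=> f1 f2 f1Q f2Q r12 r21.
  (* The union of the two bottoms lies in both facets, hence in both intervals, so uniqueness forces
     the facets to agree. *)
  pose S := glue_vertex i @: (simplex 14 (r f1) :|: simplex 14 (r f2)).
  have S1 : simplex 14 (r f1) :|: simplex 14 (r f2) \subset simplex 14 f1.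
    by rewrite subUset !simplexS.
  have S2 : simplex 14 (r f1) :|: simplex 14 (r f2) \subset simplex 14 f2.
    by rewrite subUset !simplexS.
  have [F [_ FU]] := Rpart S (mem_Cglue i f1Q S1).
  have F1 : F = glued_simplex i f1.
    apply: FU; rewrite rE // !glue_subset S1 subsetUl; split=> //.
    exact: facet_glued_simplex.
  have F2 : F = glued_simplex i f2.
    apply: FU; rewrite rE // !glue_subset S2 subsetUr; split=> //.
    exact: facet_glued_simplex.
  by have [] := glued_simplex_inj f1Q f2Q (etrans (esym F1) F2).
move=> g; rewrite mem_undup mem_filter.
case/andP=> gA /flattenP [_ /mapP [f0 f0Q ->]].
move=> /sublists_sub gf0; have gn := bound _ _ f0Q gf0.
have [F [[/facet_CglueP [j [f fQ ->]] [Rg gf]] _]] :=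
  Rpart _ (mem_Cglue i f0Q (simplexS 14 gf0)).
(* Since [g] is not inside A^*, the top of its interval belongs to the chosen copy. *)
have ij : i = j by apply: glue_subset_eq gf _; rewrite simplex_Avert.
exists f => //; rewrite -{}ij in Rg gf.
rewrite rE // !glue_subset !sub_simplex ?(bound f (r f)) // in Rg gf.
by rewrite Rg.
Qed.

End Partition.

Theorem theorem3p7 :
  balanced C37 /\
  (forall F : fieldType, CohenMacaulay F C37) /\
  ~ partitionable C37.
Proof.
split; first exact: balanced_Cglue.
split; last exact: not_partitionable_Cglue.
by move=> F; apply/constructible_CohenMacaulay/constructible_Cglue.
Qed.
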